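(* Let $J$ be a coanalytic ideal on $\omega$. The following are equivalent: (i) $J$ is weakly selective; (ii) $J$ is an intersection of a family of ideals on $\omega$ each of which has a topological representation.
   Context: An ideal on a set $E$ is a family of subsets of $E$ closed under taking subsets and finite unions; it is always assumed to contain all singletons $\{s\}$, $s\in E$. A subset of $E$ is $J$-positive if it does not belong to $J$. Subsets of $\omega$ are identified with elements of $2^\omega$ via characteristic functions, and an ideal on $\omega$ is coanalytic if it is a coanalytic ($\mathbf{\Pi}^1_1$) subset of $2^\omega$. An ideal $J$ is weakly selective if for every $b\notin J$ and every function $f:b\to\omega$ there is a $J$-positive $a\subseteq b$ such that $f\restriction a$ is either one-to-one or constant. A $\sigma$-ideal on a set $X$ is a family of subsets of $X$ closed under taking subsets and countable unions, assumed to contain all singletons of $X$. Given a separable metrizable space $X$, a $\sigma$-ideal $I$ on $X$ and a countable dense set $D\subseteq X$, let $J_I=\{a\subseteq D:\mathrm{cl}(a)\in I\}$, where $\mathrm{cl}$ is closure in $X$. An ideal $J$ on a countable set $E$ has a topological representation if there are such $X$, $I$, $D$ and a bijection $\rho:E\to D$ with $J=\{a\subseteq E:\rho(a)\in J_I\}$, where $\rho(a)$ is the image of $a$. *)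

(* Defs.v *)
From HB Require Import structures.
From mathcomp Require Import all_boot all_order all_algebra.
From mathcomp Require Import all_classical all_reals all_analysis.
Set Implicit Arguments.
Unset Strict Implicit.
Unset Printing Implicit Defensive.
Local Open Scope classical_set_scope.

Definition is_ideal (E : Type) (J : set (set E)) : Prop :=
  [/\ forall a b, a `<=` b -> J b -> J a,
      J set0,
      setU_closed J
    & forall s, J [set s]].

Definition is_sigma_ideal (X : Type) (I : set (set X)) : Prop :=
  [/\ forall A B, A `<=` B -> I B -> I A,
      I set0,
      forall A : nat -> set X, (forall n, I (A n)) -> I (\bigcup_n A n)
    & forall x, I [set x]].

(* A function b -> nat is encoded as the restriction to b of a total
   function; the values of f outside b play no role since a `<=` b. *)
Definition weakly_selective (E : Type) (J : set (set E)) : Prop :=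
  forall (b : set E) (f : E -> nat), ~ J b ->
  exists a : set E, [/\ ~ J a, a `<=` b
    & set_inj a f \/ exists c, forall x, a x -> f x = c].

Definition baire_space : Type := prod_topology (fun _ : nat => nat).

HB.instance Definition _ := Pointed.on baire_space.
HB.instance Definition _ := Nbhs.on baire_space.
HB.instance Definition _ := Topological.on baire_space.

(* Sigma^1_1 as the projections along the Baire space of closed sets;
   meant for Polish T. *)
Definition analytic (T : topologicalType) (A : set T) : Prop :=
  exists2 C : set (T * baire_space), closed C & A = fst @` C.

Definition coanalytic (T : topologicalType) (A : set T) : Prop :=
  analytic (~` A).

Definition char_functions (J : set (set nat)) : set cantor_space :=
  [set x | J [set n | x n]].

Definition coanalytic_family (J : set (set nat)) : Prop :=
  coanalytic (char_functions J).

Definition closure_ideal (X : topologicalType) (I : set (set X)) (D : set X) :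
    set (set X) :=
  [set a | a `<=` D /\ I (closure a)].

(* A metrizable space is given by a metricType, whose metric is used only
   through its topology; it is separable because D is countable and dense. *)
Definition has_topological_representation (R : realType) (E : Type)
    (J : set (set E)) : Prop :=
  exists (X : metricType R) (I : set (set X)) (D : set X) (rho : E -> X),
    [/\ is_sigma_ideal I, countable D, dense D, set_bij [set: E] D rho
      & J = [set a | closure_ideal I D (rho @` a)]].

(* Main.v *)
From HB Require Import structures.
Require Import Defs.
From mathcomp Require Import all_boot all_order all_algebra.
From mathcomp Require Import all_classical all_reals all_analysis.
From mathcomp Require Import zify lra.
Import Order.TTheory GRing.Theory Num.Theory.
Local Open Scope classical_set_scope.
Set Implicit Arguments.
Unset Strict Implicit.
Unset Printing Implicit Defensive.

(* (ii) => (i). Weak selectivity passes to intersections. If J is represented in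
   X by I and every fiber of f on a positive b is in J, let C be cl(b) minus the
   closures of the fibers. Then C is not in I, and f is unbounded on b near each
   point of C, so running through a countable base one picks a subset of b on
   which f is one-to-one and whose closure contains C.

   (i) => (ii). Given b not in J, write the complement of J as the projection of
   a closed set Q and let one player offer sets of J while the other plays
   elements of b outside them, building a set a, interleaved with digits of a
   witness w with Q a w. A winning strategy of the first player contradicts weak
   selectivity. Otherwise the other player wins, and the sets of his possible
   next moves form a countable family of positive subsets of b such that every
   member of J misses one of them: a member of J meeting all of them would
   contain the set built in some run that he wins. Iterating gives a tree of
   positive sets X_s, s a finite sequence, with X_{s i} a subset of X_s, such that
   each a in J misses an immediate successor X_{s i} of every X_s. Choose
   distinct f(s) in X_s, and let f(s) converge to x in the Baire space as s runs
   through the initial segments of x. The members of J then have nowhere dense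
   sets of limits, while b accumulates everywhere, so the ideal of sets with
   meagre set of limits contains J but not b. *)

(** * Ideals and positive sets *)

Section Ideal.
Variables (E : Type) (J : set (set E)).
Hypothesis idealJ : is_ideal J.

Lemma ideal_sub a b : a `<=` b -> J b -> J a.
Proof. by case: idealJ => + _ _ _; apply. Qed.

Lemma ideal0 : J set0. Proof. by case: idealJ. Qed.

Lemma idealU a b : J a -> J b -> J (a `|` b).
Proof. by case: idealJ => _ _ + _; apply. Qed.

Lemma ideal1 x : J [set x]. Proof. by case: idealJ. Qed.

Lemma ideal_bigcup (T : choiceType) (l : seq T) (F : T -> set E) :
  (forall x, J (F x)) -> J (\bigcup_(x in [set` l]) F x).
Proof.
move=> JF; rewrite bigcup_seq.
by elim/big_ind : _ => // *; [exact: ideal0|exact: idealU].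
Qed.

Lemma positiveD a b : ~ J a -> J b -> ~ J (a `\` b).
Proof.
move=> Ja Jb Jab; apply: Ja; apply: ideal_sub (idealU Jab Jb).
by move=> x ax; have [|] := pselect (b x); [right|left].
Qed.

End Ideal.

Lemma mem_iotaS k n : [set` iota 0 n.+1] k <-> k <= n.
Proof. by rewrite /mkset mem_iota add0n ltnS. Qed.

Lemma positive_unbounded (J : set (set nat)) : is_ideal J ->
  forall a, ~ J a -> forall n, exists2 x, a x & n <= x.
Proof.
move=> idJ a Ja n; apply: contrapT => H; apply: Ja.
apply: ideal_sub (ideal_bigcup idJ (iota 0 n) (ideal1 idJ)) => //.
move=> x ax; exists x => //=; rewrite mem_iota add0n /=.
by rewrite ltnNge; apply/negP => nx; apply: H; exists x.
Qed.

(** * Sparse positive sets from weak selectivity *)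

Lemma injective_sublevel_bounded (a : set nat) (f : nat -> nat) :
  set_inj a f -> forall n, exists M, forall x, a x -> f x <= n -> x < M.
Proof.
move=> finj; elim=> [|n [M HM]].
  have [[x [ax fx]]|H] := pselect (exists x, a x /\ f x = 0).
    exists x.+1 => y ay; rewrite leqn0 => /eqP fy.
    by rewrite (finj x y) ?inE // fx fy.
  by exists 0 => y ay; rewrite leqn0 => /eqP fy; case: H; exists y.
have [[x [ax fx]]|H] := pselect (exists x, a x /\ f x = n.+1).
  exists (maxn M x.+1) => y ay; rewrite leq_eqVlt ltnS => /orP[/eqP fy|/(HM _ ay) yM].
    by rewrite (finj y x) ?inE ?fx ?fy // leq_maxr.
  by rewrite leq_max yM.
exists M => y ay; rewrite leq_eqVlt ltnS => /orP[/eqP fy|/(HM _ ay) //].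
by case: H; exists y.
Qed.

(** Weak selectivity is used twice: first to make a rank [f] one-to-one, then to keep at most one
    element in each of a series of pairwise non-adjacent blocks of ranks. This spacing forces
    [x < f y] whenever [x] lies in an earlier block than [y]. *)
Lemma weakly_selective_sparse (J : set (set nat)) (b : set nat)
    (c : nat -> set nat) :
  is_ideal J -> weakly_selective J -> ~ J b -> (forall n, J (c n)) ->
  exists a, [/\ ~ J a, a `<=` b, (forall y, a y -> ~ c 0 y) &
    forall x y, a x -> a y -> x < y -> ~ c x y].
Proof.
move=> idJ wsJ Jb Jc.
(* The sets become increasing, and adding [k] to [c k] makes the rank [f] total with [f x <= x]. *)
pose C n := \bigcup_(k in [set` iota 0 n.+1]) (c k `|` [set k]).
have JC n : J (C n).
  by apply: ideal_bigcup => // k; apply: idealU => //; exact: ideal1.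
have C_mono m n : m <= n -> C m `<=` C n.
  move=> mn x [k /mem_iotaS km ckx]; exists k => //.
  by apply/mem_iotaS; exact: leq_trans mn.
have C_exist x : exists n, `[< C n x >].
  by exists x; apply/asboolP; exists x; [exact/mem_iotaS|right].
pose f x := ex_minn (C_exist x).
have fP x n : C n x <-> f x <= n.
  rewrite /f; case: ex_minnP => m /asboolP Cm min_m; split.
    by move=> Cn; apply: min_m; apply/asboolP.
  by move=> mn; exact: C_mono Cm.
have f_le x : f x <= x.
  by apply/fP; exists x; [exact/mem_iotaS|right].
have positive_not_sublevel a n : ~ J a -> ~ (forall x, a x -> f x <= n).
  move=> Ja afn; apply: Ja; apply: ideal_sub (JC n) => //.
  by move=> x /afn /fP.
have [a [Ja ab finj]] := wsJ b f Jb.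
have {}finj : set_inj a f.
  case: finj => // -[k ak]; exfalso; apply: (positive_not_sublevel _ k Ja).
  by move=> x /ak ->.
have [M MP] := choice (injective_sublevel_bounded finj).
(* The cut points are chosen so that elements of [a] of rank at most [N i] are less than
   [N i.+1]. *)
pose N i := iter i (fun n => maxn n.+1 (M n)) 1.
have NS i : N i.+1 = maxn (N i).+1 (M (N i)) by [].
have N_gt i : i < N i.
  by elim: i => // i IH; rewrite NS; lia.
have N_mono i j : i <= j -> N i <= N j.
  elim: j => [|j IH]; first by rewrite leqn0 => /eqP ->.
  rewrite leq_eqVlt => /orP[/eqP -> //|]; rewrite ltnS => /IH; rewrite NS; lia.
have blk_exist x : exists i, f x < N i by exists (f x).
pose blk x := ex_minn (blk_exist x).
have blkP x i : f x < N i <-> blk x <= i.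
  rewrite /blk; case: ex_minnP => m fm min_m; split; first exact: min_m.
  by move=> /N_mono; exact: leq_trans.
(* Distinct blocks of the same parity are never adjacent. *)
have [a1 [Ja1 a1a [p a1p]]] :
    exists a1, [/\ ~ J a1, a1 `<=` a & exists p, forall x, a1 x -> odd (blk x) = p].
  have [Jo|Jo] := pselect (J [set x | a x /\ odd (blk x)]).
    exists (a `\` [set x | a x /\ odd (blk x)]); split.
    - exact: positiveD.
    - by move=> x [].
    - exists false => x [ax] /= H; apply/negP => ox; exact: H.
  by exists [set x | a x /\ odd (blk x)]; split=> // [x []//|]; exists true => x [].
have [a2 [Ja2 a2a1 blk_inj]] := wsJ a1 blk Ja1.
have {}blk_inj : set_inj a2 blk.
  case: blk_inj => // -[k a2k]; exfalso.
  apply: (positive_not_sublevel _ (N k) Ja2).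
  by move=> x /a2k bx; apply: ltnW; apply/blkP; rewrite bx.
have far x y : a2 x -> blk x < blk y -> a2 y -> x < f y.
  move=> a2x bxy a2y.
  have : odd (blk x) = odd (blk y) by rewrite !(a1p _ (a2a1 _ _)).
  move=> oxy; have bxy2 : (blk x).+1 < blk y.
    by rewrite ltn_neqAle bxy andbT; apply/eqP => e; move: oxy; rewrite -e /=; case: odd.
  have fx : f x < N (blk x) by apply/blkP.
  have : x < N (blk x).+1.
    have := MP _ _ (a1a _ (a2a1 _ a2x)) (ltnW fx); rewrite NS; lia.
  move=> /leq_trans; apply; rewrite leqNgt; apply/negP => /blkP; lia.
exists (a2 `\` C 0); split.
- exact: positiveD.
- by move=> x [/a2a1/a1a/ab].
- by move=> y [_ C0y c0y]; apply: C0y; exists 0 => //; left.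
- move=> x y [a2x _] [a2y _] xy cxy.
  have fyx : f y <= x by apply/fP; exists x; [exact/mem_iotaS|left].
  have : blk x != blk y.
    by apply/eqP => /blk_inj; rewrite !inE => /(_ a2x a2y) exy; rewrite exy ltnn in xy.
  rewrite neq_ltn => /orP[bxy|byx]; first by have := far _ _ a2x bxy a2y; lia.
  by have := far _ _ a2y byx a2x; have := f_le x; lia.
Qed.

(** * Positive sets as projections of closed sets *)

(** This is closedness of [Q] in the product of the Cantor and Baire spaces, in terms of finite
    approximations. *)
Definition finitely_determined (Q : set nat -> (nat -> nat) -> Prop) : Prop :=
  forall a w, (forall k, exists a' w', Q a' w' /\
    forall i, i < k -> (a' i <-> a i) /\ w' i = w i) -> Q a w.

Lemma prod_topology_cvg_stable (K : nat -> topologicalType)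
    (u : nat -> prod_topology K) (f : prod_topology K) :
  (forall k i, i < k -> u k i = f i) -> u @ \oo --> f.
Proof.
move=> uf; apply/cvg_sup => i U [V [[W oW <-] Wf] WU].
exists i.+1 => // k /= ik; apply: WU => /=.
by rewrite /= uf.
Qed.

Lemma coanalytic_positive (J : set (set nat)) : coanalytic_family J ->
  exists Q, finitely_determined Q /\ forall a, ~ J a <-> exists w, Q a w.
Proof.
case=> C clC JC.
pose chi (a : set nat) : cantor_space := fun n => `[< a n >].
have chiK a : [set n | chi a n] = a.
  by apply/seteqP; split=> n /=; rewrite /chi; [move/asboolP|move=> ?; apply/asboolP].
exists (fun a w => C (chi a, w)); split=> [a w H|a]; last first.
  have -> : ~ J a <-> (fst @` C) (chi a) by rewrite -JC /= /char_functions /= chiK.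
  split=> [[[x w] Cxw <-]|[w Cw]]; first by exists w.
  by exists (chi a, w).
have /choice[u uP] k : exists xy : cantor_space * baire_space, C xy /\
    forall i, i < k -> xy.1 i = chi a i /\ xy.2 i = w i.
  have [a' [w' [Q' H']]] := H k; exists (chi a', w'); split=> // i /H'[ai wi].
  by split=> //=; rewrite /chi; apply: asbool_equiv_eq.
have Cu : \forall k \near \oo, C (u k) by apply: nearW => k; case: (uP k).
apply: (@closed_cvg _ _ \oo _ u C clC Cu (chi a, w)).
have u1 : (fun k => (u k).1) @ \oo --> chi a.
  by apply: prod_topology_cvg_stable => k i ik; have [_ /(_ i ik)[]] := uP k.
have u2 : (fun k => (u k).2) @ \oo --> (w : baire_space).
  by apply: prod_topology_cvg_stable => k i ik; have [_ /(_ i ik)[]] := uP k.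
rewrite (_ : u = fun k => ((u k).1, (u k).2)); first exact: cvg_pair u1 u2.
by apply/funext => k; case: (u k).
Qed.

(** * The game *)

(** The strictly decreasing lists of numbers below [n]; they code the possible histories of play. *)
Fixpoint declists (n : nat) : seq (seq nat) :=
  if n is n'.+1 then declists n' ++ [seq n' :: s | s <- declists n'] else [:: [::]].

Lemma declists_mono m n : m <= n -> {subset declists m <= declists n}.
Proof.
elim: n => [|n IH]; first by rewrite leqn0 => /eqP ->.
rewrite leq_eqVlt => /orP[/eqP -> //|]; rewrite ltnS => /IH {}IH s /IH.
by rewrite /= mem_cat => ->.
Qed.

Lemma declists_cons n s : s \in declists n -> n :: s \in declists n.+1.
Proof. by move=> sn; rewrite /= mem_cat map_f ?orbT. Qed.

Fixpoint decenum (a : set nat) (n : nat) : seq nat :=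
  if n is n'.+1 then
    if `[< a n' >] then n' :: decenum a n' else decenum a n'
  else [::].

Lemma decenum_declists a n : decenum a n \in declists n.
Proof.
elim: n => //= n IH; case: ifP => _; rewrite mem_cat; last by rewrite IH.
by rewrite map_f ?orbT.
Qed.

Lemma mem_decenum a n i : i \in decenum a n <-> a i /\ i < n.
Proof.
elim: n => [|n IH] /=; first by split=> // -[].
case: asboolP => an; last first.
  rewrite IH ltnS [i <= n]leq_eqVlt; split=> [[? ->]|[ai /orP[/eqP e|//]]].
    by rewrite orbT.
  by case: an; rewrite -e.
rewrite inE ltnS [i <= n]leq_eqVlt; split.
  by case/orP => [/eqP ->|/IH[? ->]]; rewrite ?eqxx ?orbT.
by case=> ai /orP[->//|lin]; apply/orP; right; exact/IH.
Qed.

Lemma decenumS a n :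
  decenum a n.+1 = if `[< a n >] then n :: decenum a n else decenum a n.
Proof. by []. Qed.

Arguments decenum : simpl never.

Section Game.
Variables (J : set (set nat)) (b : set nat) (Q : set nat -> (nat -> nat) -> Prop).
Hypothesis idealJ : is_ideal J.
Hypothesis Jb : ~ J b.
Hypothesis posQ : forall a, ~ J a <-> exists w, Q a w.

(* A state of the game is a pair (s, t): s lists the elements of b played so
   far and t the digits played so far of a witness w for Q. Elements played
   after t must be at least [size t], so that s already decides the part below
   [size t] of the set being built. *)
Definition consistent (s t : seq nat) : Prop :=
  exists a w, Q a w /\
    forall i, i < size t -> (a i <-> i \in s) /\ w i = nth 0 t i.

(* One player offers sets in J, the other answers with an element of b outside
   the offered set, or with a digit, and wins if infinitely many consistent
   digits are played. In a losing state the first player can confine the second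
   to V until the next digit, which leads again to a losing state. *)
Inductive losing (s t : seq nat) : Prop := Losing (V : set (seq nat)) of
    V s
  & (forall s', V s' -> forall d, consistent s' (rcons t d) -> losing s' (rcons t d))
  & (forall s', V s' -> exists a, J a /\
      forall n, b n -> size t <= n -> ~ a n -> V (n :: s')).

(* From s, J-positively many elements can be played at each step, and after
   finitely many steps a digit leading into Z. *)
Inductive winning (Z : seq nat -> seq nat -> Prop) (t : seq nat) :
    seq nat -> Prop :=
| WinDigit s d : consistent s (rcons t d) -> Z s (rcons t d) -> winning Z t s
| WinElement s N : ~ J N -> N `<=` b -> (forall n, N n -> size t <= n) ->
    (forall n, N n -> winning Z t (n :: s)) -> winning Z t s.

(** The states that are not winning serve as [V]: the elements leading from such a state to a
    winning one form a set in [J], which the first player can offer. *)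
Lemma not_losing_winning s t :
  ~ losing s t -> winning (fun s t => ~ losing s t) t s.
Proof.
move=> Ls; apply: contrapT => Ws; apply: Ls.
exists [set s' | ~ winning (fun s t => ~ losing s t) t s'] => //.
  move=> s' Ws' d cd; apply: contrapT => Ld; apply: Ws'.
  exact: WinDigit cd Ld.
move=> s' Ws'.
exists [set n | [/\ b n, size t <= n &
    winning (fun s t => ~ losing s t) t (n :: s')]]; split.
  apply: contrapT => JN; apply: Ws'; apply: WinElement JN _ _ _ => n [] //.
by move=> n bn tn Nn W; apply: Nn.
Qed.

(* The family consists of the positive sets occurring in a derivation of
   [winning]; a set meeting all of them supports a run of the game. *)
Lemma winning_family Z t s : winning Z t s ->
  exists X : set (set nat), [/\ countable X,
    forall N, X N -> ~ J N /\ N `<=` b &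
    forall a, (forall N, X N -> N `&` a !=set0) -> exists s' d,
      [/\ forall n, n \in s' -> a n /\ size t <= n,
          consistent (s' ++ s) (rcons t d) & Z (s' ++ s) (rcons t d)]].
Proof.
elim=> {s} [s d cd Zd|s N JN Nb tN _ IH].
  exists set0; split => // a _; exists [::], d; split=> //.
have {}IH n : exists X : set (set nat), [/\ countable X,
    forall M, X M -> ~ J M /\ M `<=` b &
    N n -> forall a, (forall M, X M -> M `&` a !=set0) -> exists s' d,
      [/\ forall n, n \in s' -> a n /\ size t <= n,
          consistent (s' ++ n :: s) (rcons t d) & Z (s' ++ n :: s) (rcons t d)]].
  have [/IH[X [cX X1 X2]]|Nn] := pselect (N n); first by exists X.
  by exists set0; split.
have [X XP] := choice IH.
exists (\bigcup_(o : option nat) if o is Some n then X n else [set N]); split.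
- apply: bigcup_countable => // -[n|] _; first by have [] := XP n.
  exact: countable1.
- by move=> M [[n|] _ /= XM]; [have [_ /(_ _ XM)] := XP n|rewrite XM].
- move=> a aX; have [n [Nn an]] : N `&` a !=set0 by apply: aX; exists None.
  have [_ _ /(_ Nn a)] := XP n.
  case=> [M XM|s' [d [s'a cd Zd]]]; first by apply: aX; exists (Some n).
  exists (rcons s' n), d; rewrite cat_rcons; split=> // m.
  by rewrite mem_rcons inE => /orP[/eqP ->|/s'a //]; split=> //; exact: tN.
Qed.

(** The families of all states, countably many, are united. A set meeting every member supports an
    infinite run through states that are not losing, and [Qfd] puts the set built in that run
    outside [J]. *)
Lemma not_losing_family : finitely_determined Q -> ~ losing [::] [::] ->
  exists X : set (set nat), [/\ countable X,
    forall N, X N -> ~ J N /\ N `<=` b &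
    forall a, J a -> exists2 N, X N & N `&` a = set0].
Proof.
move=> Qfd L0.
have H (st : seq nat * seq nat) : exists X : set (set nat), [/\ countable X,
    forall N, X N -> ~ J N /\ N `<=` b &
    ~ losing st.1 st.2 -> forall a, (forall N, X N -> N `&` a !=set0) ->
    exists s' d,
      [/\ forall n, n \in s' -> a n /\ size st.2 <= n,
          consistent (s' ++ st.1) (rcons st.2 d) &
          ~ losing (s' ++ st.1) (rcons st.2 d)]].
  have [L|L] := pselect (losing st.1 st.2); first by exists set0; split.
  by have [X [? ? ?]] := winning_family (not_losing_winning L); exists X; split.
have {H}[X XP] := choice H.
exists (\bigcup_st X st); split.
- by apply: bigcup_countable => // st _; have [] := XP st.
- by move=> N [st _ XN]; have [_ /(_ _ XN)] := XP st.
move=> a Ja; apply: contrapT => Xa.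
have {}Xa st N : X st N -> N `&` a !=set0.
  move=> XN; apply/set0P/eqP => Na; apply: Xa; exists N => //.
  by exists st.
have step (st : seq nat * seq nat) : exists s'd : seq nat * nat,
    ~ losing st.1 st.2 ->
      [/\ forall n, n \in s'd.1 -> a n /\ size st.2 <= n,
          consistent (s'd.1 ++ st.1) (rcons st.2 s'd.2) &
          ~ losing (s'd.1 ++ st.1) (rcons st.2 s'd.2)].
  have [L|L] := pselect (losing st.1 st.2); first by exists ([::], 0).
  have [_ _ /(_ L a (Xa st))[s' [d [? ? ?]]]] := XP st.
  by exists (s', d).
have {step}[g gP] := choice step.
pose r k := iter k (fun st : seq nat * seq nat =>
  ((g st).1 ++ st.1, rcons st.2 (g st).2)) ([::], [::]).
have rS k : r k.+1 = ((g (r k)).1 ++ (r k).1, rcons (r k).2 (g (r k)).2) by [].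
have rL k : ~ losing (r k).1 (r k).2.
  by elim: k => // k IH; rewrite rS /=; have [] := gP _ IH.
have szr k : size (r k).2 = k.
  by elim: k => // k IH; rewrite rS /= size_rcons IH.
have r1a k n : n \in (r k).1 -> a n.
  elim: k => // k IH; rewrite rS mem_cat => /orP[|//].
  by have [H _ _] := gP _ (rL k) => /H[].
(* Elements played from stage [k] on are at least [k], so the part below [k] is settled. *)
have r1_stable k j n : k <= j -> n < k -> n \in (r j).1 -> n \in (r k).1.
  elim: j => [|j IH]; first by rewrite leqn0 => /eqP ->.
  rewrite leq_eqVlt => /orP[/eqP -> //|]; rewrite ltnS => kj nk.
  rewrite rS mem_cat => /orP[|]; last exact: IH.
  have [H _ _] := gP _ (rL j) => /H[_]; rewrite szr; lia.
have r1_mono k j n : k <= j -> n \in (r k).1 -> n \in (r j).1.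
  elim: j => [|j IH]; first by rewrite leqn0 => /eqP ->.
  rewrite leq_eqVlt => /orP[/eqP -> //|]; rewrite ltnS => kj nk.
  by rewrite rS mem_cat IH ?orbT.
have r2_stable k j n : n < k -> k <= j -> nth 0 (r j).2 n = nth 0 (r k).2 n.
  move=> nk; elim: j => [|j IH]; first by rewrite leqn0 => /eqP ->.
  rewrite leq_eqVlt => /orP[/eqP -> //|]; rewrite ltnS => kj.
  by rewrite rS nth_rcons szr (leq_trans nk kj) IH.
pose a' : set nat := fun n => exists k, n \in (r k).1.
pose w n := nth 0 (r n.+1).2 n.
suff : ~ J a'.
  apply; apply: (ideal_sub idealJ) Ja; by move=> n [k /r1a].
apply/posQ; exists w; apply: Qfd => k.
have [_ [a1 [w1 [Q1 H1]]] _] := gP _ (rL k).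
exists a1, w1; split=> // i ik.
have {}H1 : (a1 i <-> i \in (r k.+1).1) /\ w1 i = nth 0 (r k.+1).2 i.
  by apply: H1; rewrite size_rcons szr ltnS ltnW.
split; last by rewrite H1.2; exact: r2_stable (ltnSn i) (leqW ik).
rewrite H1.1; split; first by exists k.+1.
case=> j ij; have [jk|kj] := leqP j k.+1; first exact: r1_mono ij.
exact: r1_stable (ltnW kj) (leqW ik) ij.
Qed.

(* For a enumerated increasingly, this makes [c 0] and [c m], for m the last
   element played, a strategy of the first player that a escapes. *)
Definition evades (c : nat -> set nat) (a : set nat) : Prop :=
  (forall y, a y -> ~ c 0 y) /\
  (forall x y, a x -> a y -> x < y -> ~ c x y).

(** By induction on the derivation: the offers that keep the state in [V] are followed up to the
    next digit, then the strategy given by induction. As [c n] knows only the last element [n], it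
    unites the offers for the finitely many histories and digits bounded by [n]. *)
Lemma losing_strategy s t : losing s t ->
  exists c : nat -> set nat, (forall n, J (c n)) /\
  forall (a : set nat) w, a `<=` b -> (forall n, exists2 x, a x & n <= x) ->
    (forall x, a x -> size t <= x) -> evades c a ->
    (forall i, i < size t -> w i = nth 0 t i) ->
    ~ Q [set n | n \in s \/ a n] w.
Proof.
elim=> {}s {}t V Vs _ IH HA.
have {HA} /choice[A AP] s' : exists a, J a /\ (V (s' ++ s) ->
    forall n, b n -> size t <= n -> ~ a n -> V (n :: s' ++ s)).
  have [/HA[a [Ja aP]]|?] := pselect (V (s' ++ s)); first by exists a.
  by exists set0; split=> //; exact: ideal0.
have {IH} /choice[B BP] (p : seq nat * nat) : exists c : nat -> set nat,
    (forall n, J (c n)) /\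
    (V (p.1 ++ s) -> consistent (p.1 ++ s) (rcons t p.2) ->
    forall (a : set nat) w, a `<=` b -> (forall n, exists2 x, a x & n <= x) ->
    (forall x, a x -> size (rcons t p.2) <= x) -> evades c a ->
    (forall i, i < size (rcons t p.2) -> w i = nth 0 (rcons t p.2) i) ->
    ~ Q [set n | n \in p.1 ++ s \/ a n] w).
  have [Vp|?] := pselect (V (p.1 ++ s)); last first.
    by exists (fun=> set0); split=> // _; exact: ideal0.
  have [cp|?] := pselect (consistent (p.1 ++ s) (rcons t p.2)); last first.
    by exists (fun=> set0); split=> // _; exact: ideal0.
  by have [c [Jc cP]] := IH _ Vp _ cp; exists c; split.
pose c n := \bigcup_(s' in [set` declists n.+1]) (A s' `|`
  \bigcup_(d in [set` iota 0 n.+1]) \bigcup_(k in [set` iota 0 n.+1]) B (s', d) k).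
exists c; split=> [n|a w ab a_unb ta [c0 cc] wt Qw].
  apply: ideal_bigcup => // s'; apply: idealU => //; first by case: (AP s').
  apply: ideal_bigcup => // d; apply: ideal_bigcup => // k.
  by case: (BP (s', d)).
(* Without a new digit the history stays in [V]: its next offer is contained in [c 0] if nothing has
   been played, and otherwise in [c x] for an element [x] already played. *)
have Vh n : V (decenum a n ++ s) /\ (decenum a n = [::] \/
    exists x, [/\ a x, x < n & decenum a n \in declists x.+1]).
  elim: n => [|n [Vn IHn]]; first by split=> //; left.
  have := decenum_declists a n.+1; rewrite decenumS; case: asboolP => an dl.
    split; last by right; exists n.
    have [_ /(_ Vn)] := AP (decenum a n); apply; [exact: ab|exact: ta|].
    move=> An; case: IHn => [e|[x [ax xn hx]]].
      by apply: (c0 _ an); exists [::] => //; left; rewrite -e.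
    by apply: (cc _ _ ax an xn); exists (decenum a n) => //; left.
  split=> //; case: IHn => [->|[x [ax xn hx]]]; [by left|right].
  by exists x; split=> //; exact: ltnW.
(* The digit [d] is declared only after an element [x >= d] of [a], so that [c y] takes it into
   account for all [y >= x]; also [x >= size t] keeps later elements at least [size (rcons t d)]. *)
pose d := w (size t).
have [x ax dx] := a_unb (maxn d (size t)).
pose a' : set nat := [set y | a y /\ x < y].
have aE : [set n | n \in s \/ a n] =
          [set n | n \in decenum a x.+1 ++ s \/ a' n].
  apply/seteqP; split=> y /=; rewrite mem_cat.
    case=> [->|ay]; rewrite ?orbT; first by left.
    have [yx|xy] := leqP y x; last by right.
    by left; apply/orP; left; apply/mem_decenum.
  by case=> [/orP[/mem_decenum[]|]|[]]; [right|left|right].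
have wt' i : i < size (rcons t d) -> w i = nth 0 (rcons t d) i.
  rewrite size_rcons ltnS leq_eqVlt nth_rcons => /orP[/eqP ->|it].
    by rewrite ltnn eqxx.
  by rewrite it wt.
have [_ /(_ (Vh x.+1).1)] := BP (decenum a x.+1, d).
have dh : decenum a x.+1 \in declists x.+1 := decenum_declists a x.+1.
have cB y k : x <= y -> k <= y -> B (decenum a x.+1, d) k `<=` c y.
  move=> xy ky z Bz; exists (decenum a x.+1); first exact: declists_mono dh.
  by right; exists d; [apply/mem_iotaS; lia|exists k => //; exact/mem_iotaS].
case/(_ _ a' w).
- rewrite aE in Qw.
  exists [set n | n \in decenum a x.+1 ++ s \/ a' n], w; split=> // i it.
  split; last exact: wt'.
  split=> [[//|[_]]|]; last by left.
  by move: it; rewrite size_rcons; lia.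
- by move=> y [/ab].
- move=> n; have [y ay ny] := a_unb (maxn n x.+1).
  by exists y; [split=> //|]; lia.
- by move=> y [_ xy]; rewrite size_rcons; lia.
- split=> [y [ay xy]|y z [ay xy] [az xz] yz] Bc.
    by apply: (cc _ _ ax ay xy); exact: cB Bc.
  by apply: (cc _ _ ay az yz); apply: cB Bc => //; exact: ltnW.
- exact: wt'.
- by rewrite -aE.
Qed.

End Game.

(** The initial state is not losing: a sparse positive set evading the first player's strategy would
    have a witness for [Q]. *)
Lemma weakly_selective_family (J : set (set nat)) (Q : set nat -> (nat -> nat) -> Prop) :
  is_ideal J -> weakly_selective J -> finitely_determined Q ->
  (forall a, ~ J a <-> exists w, Q a w) ->
  forall b, ~ J b ->
  exists X : nat -> set nat, (forall n, ~ J (X n) /\ X n `<=` b) /\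
    forall a, J a -> exists n, X n `&` a = set0.
Proof.
move=> idJ wsJ Qfd posQ b Jb.
have /(not_losing_family idJ posQ Qfd)[X [cX Xpos XJ]] : ~ losing J b Q [::] [::].
  move=> /(losing_strategy idJ)[c [Jc cP]].
  have [a [Ja ab ca0 ca]] := weakly_selective_sparse idJ wsJ Jb Jc.
  have [w Qw] := (posQ a).1 Ja.
  apply: (cP a w ab) => //; first exact: positive_unbounded Ja.
  have -> // : [set n | n \in [::] \/ a n] = a.
  by apply/seteqP; split=> [n [//|//]|n an]; right.
have [N XN _] := XJ _ (ideal0 idJ).
have /pcard_surjP[F XF] := cX.
(* Indices at which [F] leaves [X] get the default member [N]. *)
exists (fun n => if `[< X (F n) >] then F n else N); split=> [n|a /XJ[M XM Ma]].
  by case: asboolP => [|_]; exact: Xpos.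
have [n _ Fn] := XF M XM; exists n.
by rewrite Fn; case: asboolP.
Qed.

(** * Topological representations *)

Lemma topological_representation_ideal (R : realType) (E : Type)
    (K : set (set E)) : has_topological_representation R K -> is_ideal K.
Proof.
move=> [X [I [D [rho [[Isub I0 Ibig I1] _ _ [rhoD _ _] ->]]]]].
have rD a : rho @` a `<=` D by move=> _ [x _ <-]; exact: rhoD.
split.
- move=> a b ab [_ Ib]; split=> //; apply: Isub Ib.
  exact/closureS/image_subset.
- by split=> //; rewrite image_set0 closure0.
- move=> a b [_ Ia] [_ Ib]; split=> //; rewrite image_setU closureU.
  pose A n := if n is 0 then closure (rho @` a) else closure (rho @` b).
  apply: (Isub _ (\bigcup_n A n)); last by apply: Ibig => -[|n].
  by move=> x [|]; [exists 0|exists 1].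
- move=> s; split=> //; rewrite image_set1 -(closure_id _).1; first exact: I1.
  exact/accessible_closed_set1/hausdorff_accessible/metric_hausdorff.
Qed.

(** * Ultrametrics from injective codes *)

Section Ultrametric.
Variables (R : realType) (T : Type) (e : T -> nat -> nat).
Hypothesis e_inj : injective e.

(* The dummy [let]s make the instances below depend on R and e. *)
Definition ultrametric_space : Type := let _ := e_inj in let _ := R in T.

HB.instance Definition _ := Choice.copy ultrametric_space {classic T}.

Definition agree (k : nat) (x y : T) : Prop := forall i, i < k -> e x i = e y i.

Definition ultradist (x y : ultrametric_space) : R :=
  if pselect (exists n, e x n != e y n) is left H
  then ((ex_minn H).+1%:R^-1)%R else 0%R.

Lemma ultradist_lt k (x y : ultrametric_space) :
  (ultradist x y < k.+1%:R^-1)%R <-> agree k.+1 x y.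
Proof.
rewrite /ultradist; case: pselect => [H|H]; last first.
  rewrite invr_gt0 ltr0n; split=> // _ i _.
  by apply/eqP; apply: contrapT => /negP xyi; apply: H; exists i.
case: ex_minnP => n xyn n_min.
rewrite ltf_pV2 ?posrE ?ltr0n // ltr_nat ltnS; split=> [kn i ik|xy].
  apply/eqP; apply: contrapT => /negP /n_min; lia.
by rewrite ltnNge; apply/negP => nk; move: xyn; rewrite xy ?eqxx.
Qed.

Lemma ultradist_ge0 x y : (0 <= ultradist x y)%R.
Proof. by rewrite /ultradist; case: pselect => // H; rewrite invr_ge0 ler0n. Qed.

Lemma ultradistxx x : ultradist x x = 0%R.
Proof. by rewrite /ultradist; case: pselect => // H; exfalso; case: H => n /eqP. Qed.

Lemma ultradist_positivity x y : ultradist x y = 0%R -> x = y.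
Proof.
move=> d0; apply: e_inj; apply/funext => n.
suff /ultradist_lt /(_ n (ltnSn n)) : (ultradist x y < n.+1%:R^-1)%R by [].
by rewrite d0 invr_gt0 ltr0n.
Qed.

Lemma ultradist_sym x y : ultradist x y = ultradist y x.
Proof.
wlog : x y / (ultradist x y < ultradist y x)%R.
  by move=> H; case: (ltgtP (ultradist x y) (ultradist y x)) => // /H.
rewrite {2}/ultradist; case: pselect => [H|_]; last first.
  by rewrite ltNge ultradist_ge0.
case: ex_minnP => n yxn _ /ultradist_lt /(_ n (ltnSn n)) xyn.
by rewrite xyn eqxx in yxn.
Qed.

Lemma ultradist_triangle y x z :
  (ultradist x z <= ultradist x y + ultradist y z)%R.
Proof.
rewrite {1}/ultradist; case: pselect => [H|_]; last first.
  by rewrite addr_ge0 ?ultradist_ge0.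
case: ex_minnP => n xzn _.
have [xy|/ultradist_lt xy] := leP (n.+1%:R^-1)%R (ultradist x y).
  by rewrite (le_trans xy) // lerDl ultradist_ge0.
have [yz|/ultradist_lt yz] := leP (n.+1%:R^-1)%R (ultradist y z).
  by rewrite (le_trans yz) // lerDr ultradist_ge0.
by move: xzn; rewrite xy ?ltnSn // yz ?ltnSn ?eqxx.
Qed.

HB.instance Definition _ := isMetric.Build R ultrametric_space
  ultradistxx ultradist_positivity ultradist_sym ultradist_triangle.

Lemma closure_ultrametric (A : set ultrametric_space) x :
  closure A x <-> forall k, exists2 y, A y & agree k x y.
Proof.
split=> [clA k|clA B].
  have /clA[y [Ay]] : nbhs x (ball x (k.+1%:R^-1)%R : set ultrametric_space).
    by apply: nbhsx_ballx; rewrite invr_gt0 ltr0n.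
  rewrite ballEmdist /= => /ultradist_lt xy; exists y => // i ik.
  exact/xy/leqW.
move=> /nbhs_ballP[eps /= eps0 xB].
have [k keps] : exists k, (k.+1%:R^-1 < eps)%R.
  exists (Num.truncn eps^-1)%R.
  rewrite invf_plt ?posrE ?ltr0n //; exact: truncnS_gt.
have [y Ay xy] := clA k.+1; exists y; split=> //; apply: xB.
rewrite ballEmdist /=; apply: lt_trans keps; exact/ultradist_lt.
Qed.

End Ultrametric.

(** * Meagre sets of branches and the represented ideal *)

Section Branching.
Variable p : nat -> seq nat.

(* inl n is the point attached to n, at the node p n of the tree of finite
   sequences, and inr x is an infinite branch. The codes of branches have no
   zero; that of inl n is p n shifted by one, then a zero, then n forever. *)
Definition branch_code (z : nat + (nat -> nat)) (i : nat) : nat :=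
  match z with
  | inl n => if i < size (p n) then (nth 0 (p n) i).+1
             else if i == size (p n) then 0 else n
  | inr x => (x i).+1
  end.

Lemma branch_code_inj : injective branch_code.
Proof.
have code0 n : branch_code (inl n) (size (p n)) = 0 by rewrite /= ltnn eqxx.
have codeS n i : size (p n) < i -> branch_code (inl n) i = n.
  by move=> /= ni; rewrite ltnNge (ltnW ni) /= gtn_eqF.
have code_gt0 n i : i < size (p n) -> branch_code (inl n) i != 0.
  by move=> /= ->.
move=> [n|x] [m|y] H.
- have nm : size (p n) = size (p m).
    case: (ltngtP (size (p n)) (size (p m))) => //.
      by move=> /code_gt0; rewrite -H code0.
    by move=> /code_gt0; rewrite H code0.
  by have := codeS n _ (ltnSn _); rewrite H nm codeS // => ->.
- by have := code0 n; rewrite H.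
- by have := code0 m; rewrite -H.
- congr inr; apply/funext => i; by have /= [] := congr1 (fun f => f i) H.
Qed.

(** Nowhere density in the Baire space, expressed by the cylinders of finite sequences. *)
Definition nwd (N : set (nat -> nat)) : Prop :=
  forall s, exists s', forall x, N x ->
    ~ forall i, i < size (s ++ s') -> x i = nth 0 (s ++ s') i.

Definition meagre (A : set (nat -> nat)) : Prop :=
  exists N : nat -> set (nat -> nat),
    (forall j, nwd (N j)) /\ A `<=` \bigcup_j N j.

Lemma meagreT : ~ meagre setT.
Proof.
move=> [N [nwdN NT]].
have /choice[g gP] (js : nat * seq nat) := nwdN js.1 js.2.
(* As in the Baire category theorem, stage [j] avoids [N j]; the appended 0 makes the lengths grow,
   so the limit is defined everywhere. *)
pose s j := iteri j (fun j s => s ++ g (j, s) ++ [:: 0]) [::].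
have sS j : s j.+1 = s j ++ g (j, s j) ++ [:: 0] by [].
have sz j : j <= size (s j).
  by elim: j => // j IH; rewrite sS !size_cat /=; lia.
have sz_mono j k : j <= k -> size (s j) <= size (s k).
  elim: k => [|k IH]; first by rewrite leqn0 => /eqP ->.
  rewrite leq_eqVlt => /orP[/eqP -> //|]; rewrite ltnS => /IH.
  by rewrite sS size_cat; lia.
have nth_s j k i : j <= k -> i < size (s j) -> nth 0 (s k) i = nth 0 (s j) i.
  elim: k => [|k IH]; first by rewrite leqn0 => /eqP ->.
  rewrite leq_eqVlt => /orP[/eqP -> //|]; rewrite ltnS => jk ij.
  by rewrite sS nth_cat (leq_trans ij (sz_mono _ _ jk)) IH.
pose x i := nth 0 (s i.+1) i.
have xs j i : i < size (s j) -> x i = nth 0 (s j) i.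
  move=> ij; rewrite /x; have [ji|ji] := leqP j i.+1; first exact: nth_s.
  by rewrite -(nth_s i.+1 j) // ltnW.
have [j _ Nx] := NT x I.
apply: (gP (j, s j) x Nx) => /= i ij; rewrite (xs j.+1) sS catA.
  by rewrite nth_cat ij.
by rewrite size_cat ltn_addr.
Qed.

Definition branch_limits (a : set nat) : set (nat -> nat) :=
  [set x | forall k, exists n, [/\ a n, k <= size (p n) &
    forall i, i < k -> x i = nth 0 (p n) i]].

(** The sigma-ideal consists of the sets with meagre trace on the branches. The points [inl n] are
    dense because every finite sequence is extended by some [p n]. *)
Lemma branching_representation (R : realType) :
  (forall s, exists n s', p n = s ++ s') ->
  has_topological_representation R [set a | meagre (branch_limits a)].
Proof.
move=> pP.
pose X : metricType R := ultrametric_space R branch_code_inj.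
pose I : set (set X) := [set A | meagre [set x | A (inr x)]].
have clE (A : set X) x : closure A x <-> forall k, exists2 y, A y &
    agree branch_code k x y by exact: closure_ultrametric.
have agree_inr k x n : agree branch_code k (inr x) (inl n) <->
    k <= size (p n) /\ forall i, i < k -> x i = nth 0 (p n) i.
  split=> [xn|[kn xn] i ik]; last by rewrite /= (leq_trans ik kn) xn.
  have kn : k <= size (p n).
    by rewrite leqNgt; apply/negP => /xn /=; rewrite ltnn eqxx.
  split=> // i ik; have := xn i ik.
  by rewrite /= (leq_trans ik kn) => -[].
have rhoa (a : set nat) : [set x | closure ((inl : nat -> X) @` a) (inr x)] =
    branch_limits a.
  apply/seteqP; split=> x /=.
    move=> /clE clx k; have [_ [n an <-] /agree_inr[kn xn]] := clx k.
    by exists n.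
  move=> H; apply/clE => k; have [n [an kn xn]] := H k.
  by exists (inl n); [exists n|apply/agree_inr].
exists X, I, (range (inl : nat -> X)), inl; split.
- split.
  + move=> A B AB [N [nwdN BN]]; exists N; split=> // x /AB; exact: BN.
  + by exists (fun=> set0); split=> // _ s; exists [::].
  + move=> A /choice[N NP].
    exists (fun j => if unpickle j is Some (n, k) then N n k else set0); split.
      move=> j; case: unpickle => [[n k]|]; first by case: (NP n).
      by move=> s; exists [::].
    move=> x [n _ /(NP n).2[k _ Nx]]; exists (pickle (n, k)) => //.
    by rewrite pickleK.
  + move=> z; exists (fun=> [set x | z = inr x]); split=> [_ s|x /= <-]; last by exists 0.
    case: z => [n|y]; first by exists [::].
    (* The extension differs from [y] at index [size s], so a single branch is nowhere dense. *)
    exists [:: (y (size s)).+1] => x [<-] /(_ (size s)).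
    by rewrite size_cat /= addn1 ltnSn nth_cat ltnn subnn /= => /(_ isT); lia.
- exact: (sub_countable (card_image_le _ _)).
- move=> O [z Oz] oO.
  have : closure (range (inl : nat -> X)) z.
    apply/clE => k; case: z {Oz} => [n|x]; first by exists (inl n).
    have [n [s' pn]] := pP (mkseq x k); exists (inl n) => //.
    apply/agree_inr; rewrite pn size_cat size_mkseq leq_addr; split=> // i ik.
    by rewrite nth_cat size_mkseq ik nth_mkseq.
  move=> /(_ O) []; first exact: open_nbhs_nbhs.
  by move=> y [Dy Oy]; exists y.
- split; [by move=> n _; exists n|by move=> n m _ _ []|by move=> _ [n _ <-]; exists n].
- apply/seteqP; split=> a /=.
    by move=> ma; split=> [_ [n _ <-]|]; [exists n|rewrite /I /= rhoa].
  by case=> _; rewrite /I /= rhoa.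
Qed.

End Branching.

(** * Separating the ideal from a positive set *)

(** Values are chosen strictly increasing along an enumeration of the finite sequences. *)
Lemma unbounded_injection (Y : seq nat -> set nat) :
  (forall s n, exists2 x, Y s x & n <= x) ->
  exists f, injective f /\ forall s, Y s (f s).
Proof.
move=> Yunb.
have /choice[h hP] (sn : seq nat * nat) : exists x, Y sn.1 x /\ sn.2 <= x.
  by have [x Yx nx] := Yunb sn.1 sn.2; exists x.
pose S k : seq nat := odflt [::] (unpickle k).
pose g k := iteri k.+1 (fun k m => h (S k, m.+1)) 0.
have gS k : g k.+1 = h (S k.+1, (g k).+1) by [].
have g_mono i j : i < j -> g i < g j.
  elim: j => // j IH; rewrite ltnS leq_eqVlt gS.
  case/orP => [/eqP ->|/IH ij]; have [_ /= +] := hP (S j.+1, (g j).+1); lia.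
exists (g \o pickle); split=> [s t /= st|s /=].
  apply: (pcan_inj (@pickleK _)).
  by case: (ltngtP (pickle s) (pickle t)) => // /g_mono; rewrite st ltnn.
have /= [+ _] := hP (S (pickle s), (iteri (pickle s) (fun k m => h (S k, m.+1)) 0).+1).
by rewrite {1}/S pickleK.
Qed.

Lemma weakly_selective_separation (R : realType) (J : set (set nat)) :
  is_ideal J -> coanalytic_family J -> weakly_selective J ->
  forall b, ~ J b -> exists K,
    [/\ is_ideal K, has_topological_representation R K, J `<=` K & ~ K b].
Proof.
move=> idJ /coanalytic_positive[Q [Qfd posQ]] wsJ b Jb.
have /choice[Phi PhiP] (c : set nat) : exists X : nat -> set nat, ~ J c ->
    (forall n, ~ J (X n) /\ X n `<=` c) /\
    forall a, J a -> exists n, X n `&` a = set0.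
  have [Jc|Jc] := pselect (J c); first by exists (fun=> set0).
  by have [X XP] := weakly_selective_family idJ wsJ Qfd posQ Jc; exists X.
pose X (s : seq nat) := foldl Phi b s.
have X_rcons s i : X (rcons s i) = Phi (X s) i by rewrite /X foldl_rcons.
have JX s : ~ J (X s).
  elim/last_ind: s => [//|s i IH]; rewrite X_rcons.
  by have [/(_ i)[]] := PhiP _ IH.
have X_cat s t : X (s ++ t) `<=` X s.
  elim/last_ind: t => [|t i IH]; first by rewrite cats0.
  rewrite -rcons_cat X_rcons; apply: subset_trans IH.
  by have [/(_ i)[]] := PhiP _ (JX (s ++ t)).
have [f [f_inj fX]] := unbounded_injection (fun s => positive_unbounded idJ (JX s)).
(* [p] inverts [f]; numbers outside the range of [f] go to the root, where they contribute no
   limits. *)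
have /choice[p pP] n : exists s, (s != [::] -> f s = n) /\ forall t, f t = n -> s = t.
  have [[s fs]|nf] := pselect (exists s, f s = n).
    by exists s; split=> // t; rewrite -fs => /f_inj.
  by exists [::]; split=> // t ft; case: nf; exists t.
have pf s : p (f s) = s by apply: (pP (f s)).2.
have rep : has_topological_representation R [set a | meagre (branch_limits p a)].
  by apply: branching_representation => s; exists (f s), [::]; rewrite pf cats0.
exists [set a | meagre (branch_limits p a)]; split=> //.
- exact: topological_representation_ideal rep.
(* The limits of [a] are already nowhere dense: below [s] there is [i] with [X (rcons s i)] disjoint
   from [a], while a limit through [rcons s i] would need an element of [a] in that set. *)
- move=> a Ja; exists (fun=> branch_limits p a); split=> [_ s|x]; last by exists 0.
  have [_ /(_ a Ja)[i Xa]] := PhiP _ (JX s).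
  exists [:: i] => x ax xs; rewrite cats1 in xs.
  have [n [an sn xn]] := ax (size (rcons s i)).
  have pn : p n = rcons s i ++ drop (size (rcons s i)) (p n).
    rewrite -[LHS](cat_take_drop (size (rcons s i))); congr cat.
    apply: (@eq_from_nth _ 0); rewrite size_takel // => j js.
    by rewrite nth_take // -xn // xs.
  suff : (Phi (X s) i `&` a) n by rewrite Xa.
  split=> //; rewrite -X_rcons; apply: (X_cat _ (drop (size (rcons s i)) (p n))).
  rewrite -pn; have <- : f (p n) = n; last by rewrite pf; exact: fX.
  by apply: (pP n).1; rewrite pn; case: (s).
- rewrite /= (_ : branch_limits p b = setT); first exact: meagreT.
  apply/seteqP; split=> // x _ k; exists (f (mkseq x k)).
  rewrite pf size_mkseq; split=> // [|i ik]; last by rewrite nth_mkseq.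
  by apply: (X_cat [::] (mkseq x k)); exact: fX.
Qed.

(** * Weak selectivity of represented ideals *)

(** The base consists of balls of radius [1/(k+1)] centred in [D], indexed by codes of centre and
    [k]. *)
Lemma countable_dense_base (R : realType) (X : metricType R) (D : set X) :
  countable D -> dense D ->
  exists U : nat -> set X, forall (x : X) V, nbhs x V ->
    exists i, nbhs x (U i) /\ U i `<=` V.
Proof.
move=> /countable_injP[g g_inj] dD.
pose U i := if unpickle i is Some (m, k) then
  [set z | exists d, [/\ D d, g d = m & ball d (k.+1%:R^-1)%R z]] else set0.
exists U => x V Vx; have /nbhs_ballP[eps /= eps0 xV] := Vx.
have [k keps] : exists k, (k.+1%:R^-1 < eps / 2)%R.
  exists (Num.truncn (eps / 2)^-1)%R.
  by rewrite invf_plt ?posrE ?ltr0n ?divr_gt0 //; exact: truncnS_gt.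
have k0 : (0 < k.+1%:R^-1 :> R)%R by rewrite invr_gt0 ltr0n.
have [d [xd Dd]] : ((ball x (k.+1%:R^-1 / 2)%R)° `&` D) !=set0.
  apply: dD; last exact: open_interior.
  by exists x; apply: nbhsx_ballx; rewrite divr_gt0.
have {}xd : ball x (k.+1%:R^-1 / 2)%R d by exact: interior_subset xd.
exists (pickle (g d, k)); rewrite /U pickleK; split.
  apply: filterS (nbhsx_ballx x (k.+1%:R^-1 / 2)%R _); last by rewrite divr_gt0.
  move=> z xz; exists d; split=> //.
  by rewrite [X in ball _ X]splitr; apply: ball_triangle xz; exact: ball_sym.
move=> z [d' [Dd' gd dz]]; apply: xV.
have ? : d' = d by apply: g_inj => //; rewrite inE.
subst d'; apply: le_ball (ball_triangle xd dz).
by move: keps k0; set q := (_^-1)%R; lra.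
Qed.

Lemma topological_representation_weakly_selective (R : realType) (E : Type)
    (K : set (set E)) : has_topological_representation R K -> weakly_selective K.
Proof.
move=> [X [I [D [rho [[Isub I0 Ibig I1] cD dD [rhoD rho_inj _] KE]]]]].
have KP a : K a <-> I (closure (rho @` a)).
  by rewrite KE; split=> [[]//|Ia]; split=> // _ [x _ <-]; exact: rhoD.
move=> b f Kb.
have [[n Kn]|Kfib] := pselect (exists n, ~ K (b `&` f @^-1` [set n])).
  exists (b `&` f @^-1` [set n]); split=> //; right.
  by exists n => x [].
have {}Kfib n : I (closure (rho @` (b `&` f @^-1` [set n]))).
  by apply/KP; apply: contrapT => ?; apply: Kfib; exists n.
pose C := closure (rho @` b) `\` \bigcup_n closure (rho @` (b `&` f @^-1` [set n])).
have IC : ~ I C.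
  move=> IC; apply: Kb; apply/KP.
  pose A n := if n is m.+1 then closure (rho @` (b `&` f @^-1` [set m])) else C.
  apply: (Isub _ (\bigcup_n A n)); last by apply: Ibig => -[|n] //; exact: Kfib.
  move=> x bx; have [[m _ mx]|nx] := pselect
    ((\bigcup_n closure (rho @` (b `&` f @^-1` [set n]))) x); first by exists m.+1.
  by exists 0.
(* A point of [C] has a neighbourhood missing the images of the first [N] fibers, yet [b]
   accumulates at it. *)
have C_unb x (B : set X) N : C x -> nbhs x B ->
    exists y, [/\ b y, B (rho y) & N <= f y].
  move=> [bx nx] xB.
  have {}nx n : nbhs x (~` (rho @` (b `&` f @^-1` [set n]))).
    apply: contrapT => H; apply: nx; exists n => // V xV.
    apply: contrapT => H'; apply: H; apply: filterS xV => z Vz rz.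
    by apply: H'; exists z.
  have yN : nbhs x [set z | forall n, n < N -> ~ (rho @` (b `&` f @^-1` [set n])) z].
    elim: (N) => [|M IH]; first by apply: nearW => z n.
    apply: filterS (filterI IH (nx M)) => z [zM z'] n.
    by rewrite ltnS leq_eqVlt => /orP[/eqP -> //|/zM].
  have [_ [[y by_ <-] [By {}yN]]] := bx _ (filterI xB yN).
  exists y; split=> //; rewrite leqNgt; apply/negP => /yN; apply.
  by exists y.
have [U UP] := countable_dense_base cD dD.
pose good i := exists2 x, C x & nbhs x (U i).
have [y0 _] : exists y : E, True.
  have [x Cx] : C !=set0.
    by apply/set0P/eqP => C0; apply: IC; rewrite C0.
  by have [y _] := C_unb x setT 0 Cx filterT; exists y.
have /choice[h hP] (iN : nat * nat) : exists y, good iN.1 ->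
    [/\ b y, U iN.1 (rho y) & iN.2 <= f y].
  have [[x Cx xU]|ng] := pselect (good iN.1); last by exists y0.
  by have [y yP] := C_unb x _ iN.2 Cx xU; exists y.
(* [M i] exceeds the values of [f] at all earlier choices, so [f] strictly increases along the good
   indices. *)
pose M i := iteri i (fun i N => maxn N (f (h (i, N))).+1) 0.
have MS i : M i.+1 = maxn (M i) (f (h (i, M i))).+1 by [].
have M_mono i j : i <= j -> M i <= M j.
  elim: j => [|j IH]; first by rewrite leqn0 => /eqP ->.
  rewrite leq_eqVlt => /orP[/eqP -> //|]; rewrite ltnS => /IH; rewrite MS; lia.
have f_lt i j : good j -> i < j -> f (h (i, M i)) < f (h (j, M j)).
  move=> gj ij; have [_ _ /=] := hP (j, M j) gj.
  by have := M_mono _ _ ij; rewrite MS; lia.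
pose a := [set h (i, M i) | i in good].
exists a; split.
- move=> /KP Ia; apply: IC; apply: Isub Ia => x Cx V xV.
  have [i [xU UV]] := UP x V xV.
  have gi : good i by exists x.
  have [_ Uh _] := hP (i, M i) gi.
  by exists (rho (h (i, M i))); split; [exists (h (i, M i)) => //; exists i|exact: UV].
- by move=> _ [i gi <-]; have [] := hP (i, M i) gi.
- left=> _ _ /set_mem[i gi <-] /set_mem[j gj <-] ff.
  case: (ltngtP i j) => [/(f_lt _ _ gj)|/(f_lt _ _ gi)|-> //]; by rewrite ff ltnn.
Qed.

Theorem theorem1p6 (R : realType) (J : set (set nat)) :
  is_ideal J -> coanalytic_family J ->
  weakly_selective J <->
  exists F : set (set (set nat)),
    (forall K, F K -> is_ideal K /\ has_topological_representation R K) /\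
    J = \bigcap_(K in F) K.
Proof.
move=> idJ coJ; split=> [wsJ|[F [FP ->]] b f].
  exists [set K | [/\ is_ideal K, has_topological_representation R K & J `<=` K]].
  split=> [K []//|]; apply/seteqP; split=> [a Ja K [_ _]|b Kb]; first exact.
  apply: contrapT => Jb.
  have [K [? ? ? nKb]] := weakly_selective_separation R idJ coJ wsJ Jb.
  by apply: nKb; exact: Kb.
move=> Jb; have [K [FK Kb]] : exists K, F K /\ ~ K b.
  apply: contrapT => H; apply: Jb => K FK; apply: contrapT => Kb.
  by apply: H; exists K.
have [a [Ka ab fa]] :=
  topological_representation_weakly_selective (FP K FK).2 f Kb.
by exists a; split=> // /(_ K FK).
Qed.
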